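(* Let $A\in\mathbb{R}^{n_x\times n_x}$, $B\in\mathbb{R}^{n_x\times n_u}$, $E\in\mathbb{R}^{n_x\times n_w}$, $K\in\mathbb{R}^{n_u\times n_x}$, $\Sigma_w\succ 0$ in $\mathbb{R}^{n_w\times n_w}$ and $\varepsilon\in(0,1)$. Assume $\|A+BK\|<1$, $(A+BK,E)$ is reachable, and $BK\neq 0$. Suppose $r>0$ satisfies $$r^2>\frac{1}{(1-\|A+BK\|)^2}\,\frac1\varepsilon\operatorname{Tr}(\Sigma_wE^\top E).$$ Consider the system $x_{t+1}=Ax_t+Bu_t+Ew_t$ with the event-triggered control $u_t=K\hat x_t$, where $\hat x_t=x_{t_k}$ for $t\in[t_k,t_{k+1})$, $t_0=0$, and the triggering times are $$t_{k+1}=\min\{t>t_k:\ \|x_{t_k}-x_t\|>\sigma_3\}.$$ If $$\sigma_3\le\frac{1}{\|BK\|}\left((1-\|A+BK\|)\,r-\sqrt{\frac1\varepsilon\operatorname{Tr}(\Sigma_wE^\top E)}\right),$$ then positive invariance with $\mathcal{D}=\{x\in\mathbb{R}^{n_x}:\|x\|^2-r^2\le0\}$ is guaranteed: for any state $x_t\in\mathcal{D}$, $\sup_{\mathbb{P}\in\mathcal{P}_k}\mathbb{P}\text{-CVaR}_\varepsilon[\|x_{t+k}\|^2-r^2]\le0$ for all $k\in\mathbb{Z}_{>0}$.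
   Context: $\|\cdot\|$ is the Euclidean norm on vectors and the maximum singular value on matrices; $M\succ 0$ means positive definite. Reachability of $(A+BK,E)$ means $\operatorname{rank}[E,(A+BK)E,\dots,(A+BK)^{n_x-1}E]=n_x$. CVaR: for a probability distribution $\mathbb{P}$ of a random vector $\xi$ and a measurable loss $L$, at level $\varepsilon\in(0,1)$, $\mathbb{P}\text{-CVaR}_\varepsilon[L(\xi)]=\inf_{\beta\in\mathbb{R}}\{\beta+\frac1\varepsilon\mathbb{E}_{\mathbb{P}}[(L(\xi)-\beta)^+]\}$, where $x^+=\max\{x,0\}$. The worst-case CVaR over a set of distributions is the supremum of CVaR over that set. Setting: the disturbances $w_t\in\mathbb{R}^{n_w}$, $t\in\mathbb{Z}_{\ge0}$, are i.i.d. with mean zero and covariance $\Sigma_w$, but their distribution is otherwise unknown. $\mathcal{P}_k$ is the set of all probability distributions on $\mathbb{R}^{n_wk}$ with mean zero and covariance $I_k\otimes\Sigma_w$. With $e_t=\hat x_t-x_t$ the closed loop reads $x_{t+1}=(A+BK)x_t+BKe_t+Ew_t$. If the set defining $t_{k+1}$ is empty, $t_{k+1}=\infty$; at a triggering time $\hat x_t$ is reset to $x_t$ (so $e_t=0$). In the positive invariance conclusion, the current state $x_t\in\mathcal{D}$ and the currently held state $\hat x_t$ (any value consistent with the trigger rule, i.e. $\hat x_t=x_t$ or $\|\hat x_t-x_t\|\le\sigma_3$) are regarded as given deterministic vectors at time $t$; the closed loop is then run forward with the trigger rule, so $x_{t+k}$ is a function of these and of the stacked disturbance $[w_t^\top,\dots,w_{t+k-1}^\top]^\top$,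 whose law ranges over $\mathcal{P}_k$. *)

(* Defs.v *)
From HB Require Import structures.
From mathcomp Require Import all_boot all_order all_algebra.
From mathcomp.real_closed Require Import mxtens.
From mathcomp Require Import all_classical all_reals all_analysis.
Import Order.TTheory GRing.Theory Num.Theory.
Import numFieldNormedType.Exports.

Set Implicit Arguments.
Unset Strict Implicit.
Unset Printing Implicit Defensive.

Local Open Scope classical_set_scope.
Local Open Scope ring_scope.

Section Matrices.
Context {R : realType}.

(* The library's norm on matrices is the max-norm, hence this definition. *)
Definition enorm n (x : 'cV[R]_n) : R := Num.sqrt (\sum_i x i 0 ^+ 2).

Definition singular_values m n (M : 'M[R]_(m, n)) : set R :=
  [set Num.sqrt a | a in [set a | eigenvalue (M^T *m M) a]].

Definition safe_set n (r : R) : set 'cV[R]_n :=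
  [set x | enorm x ^+ 2 - r ^+ 2 <= 0].

(* [singular_values M] is finite, so the supremum is a maximum; it is 0 when
   M has no columns. *)
Definition snorm m n (M : 'M[R]_(m, n)) : R := sup (singular_values M).

Definition posdefmx n (M : 'M[R]_n) : Prop :=
  M^T = M /\ forall v : 'cV[R]_n, v != 0 -> 0 < (v^T *m M *m v) 0 0.

Definition reachable n m (F : 'M[R]_n) (E : 'M[R]_(n, m)) : Prop :=
  \rank (\mxrow_(i < n) (F ^+ i *m E)) = n.

End Matrices.

Section CVaR.
Context {d : measure_display} {T : measurableType d} {R : realType}.
Local Open Scope ereal_scope.

Definition CVaR (eps : R) (P : probability T R) (L : T -> R) : \bar R :=
  ereal_inf
    [set beta%:E + (1 / eps)%:E * 'E_P[(fun w => Num.max (L w - beta) 0)%R]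
    | beta in [set: R]].

Definition worst_case_CVaR (eps : R) (Ps : set (probability T R)) (L : T -> R)
    : \bar R :=
  ereal_sup [set CVaR eps P L | P in Ps].

End CVaR.

Section Ambiguity.
Context {R : realType}.

(* Laws on R^n, as probabilities on n.-tuple R with the product of the Borel
   sigma-algebras, with mean zero and covariance matrix S. Square
   integrability is explicit because the library's expectation and covariance
   are total functions. *)
Definition centered_laws n (S : 'M[R]_n) : set (probability (n.-tuple R) R) :=
  [set P : probability (n.-tuple R) R |
    [/\ forall i, (fun w : n.-tuple R => tnth w i) \in Lfun P 2%:E,
        forall i, ('E_P[fun w : n.-tuple R => tnth w i] = 0)%E &
        forall i j, covariance P (fun w => tnth w i) (fun w => tnth w j)
                    = (S i j)%:E]].

(* The Kronecker product 1%:M *t S is indexed through [mxtens_index]. *)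
Definition disturbance_laws nw (S : 'M[R]_nw) k :
    set (probability ((k * nw).-tuple R) R) :=
  centered_laws ((1%:M : 'M[R]_k) *t S).

(* The s-th block of a stacked vector; zero beyond the horizon k, where it is
   never used. *)
Definition block nw k (w : (k * nw).-tuple R) (s : nat) : 'cV[R]_nw :=
  \col_i (if insub s is Some j then tnth w (mxtens_index (j : 'I_k, i)) else 0).

End Ambiguity.

Arguments disturbance_laws {R nw} S k.

Section ClosedLoop.
Context {R : realType} {nx nu nw : nat}.
Variables (A : 'M[R]_nx) (B : 'M[R]_(nx, nu)) (E : 'M[R]_(nx, nw)).
Variables (K : 'M[R]_(nu, nx)) (sigma3 : R).

Definition closed_loop_step (s : 'cV[R]_nx * 'cV[R]_nx) (w : 'cV[R]_nw) :=
  let: (x, xhat) := s in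
  let u := K *m xhat in
  let x' := A *m x + B *m u + E *m w in
  (x', if sigma3 < enorm (xhat - x') then x' else xhat).

(* [closed_loop s w k] is the pair of the state and of the held state after k
   steps from s, under the disturbances w 0, ..., w k.-1; the lemmas below
   relate it to the triggering times. *)
Fixpoint closed_loop (s : 'cV[R]_nx * 'cV[R]_nx) (w : nat -> 'cV[R]_nw) k :=
  if k is k'.+1 then closed_loop_step (closed_loop s w k') (w k') else s.

Definition next_trigger (x : nat -> 'cV[R]_nx) (tk : nat) : option nat :=
  if pselect (exists t, (tk < t)%N && (sigma3 < enorm (x tk - x t)))
  is left h then Some (ex_minn h) else None.

(* [None] stands for infinity. *)
Definition trigger_time (x : nat -> 'cV[R]_nx) (k : nat) : option nat :=
  iter k (obind (next_trigger x)) (Some 0%N).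

Lemma closed_loopS2 s w t : (closed_loop s w t.+1).2 =
  if sigma3 < enorm ((closed_loop s w t).2 - (closed_loop s w t.+1).1)
  then (closed_loop s w t.+1).1 else (closed_loop s w t).2.
Proof. by rewrite /= /closed_loop_step; case: (closed_loop s w t). Qed.

Lemma closed_loopS1 s w t : (closed_loop s w t.+1).1 =
  A *m (closed_loop s w t).1 + B *m (K *m (closed_loop s w t).2) + E *m w t.
Proof. by rewrite /= /closed_loop_step; case: (closed_loop s w t). Qed.

Lemma closed_loop_held x0 w (x := fun t => (closed_loop (x0, x0) w t).1)
    k tk t :
  trigger_time x k = Some tk -> (tk <= t)%N ->
  (forall t', trigger_time x k.+1 = Some t' -> (t < t')%N) ->
  (closed_loop (x0, x0) w t).2 = x tk.
Proof.
pose h t := (closed_loop (x0, x0) w t).2.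
have holds i : h i = x i -> forall j, (i <= j)%N ->
    (forall t', next_trigger x i = Some t' -> (j < t')%N) -> h j = x i.
  move=> hi; elim=> [|j IH]; first by case: i hi.
  rewrite leq_eqVlt => /orP[/eqP e|ij] nt; first by subst i.
  have hj : h j = x i by apply: IH => // t' /nt /ltnW.
  rewrite /h closed_loopS2 -/(h j) -/(x j.+1) hj.
  case: ifP => // trig; move: nt; rewrite /next_trigger.
  case: pselect => [ex|[]]; last by exists j.+1; rewrite ij trig.
  move=> /(_ _ erefl); case: ex_minnP => m _ /(_ j.+1); rewrite ij trig.
  by move=> /(_ isT) le lt; have := leq_trans lt le; rewrite ltnn.
have hx : forall i ti, trigger_time x i = Some ti -> h ti = x ti.
  elim=> [ti [<-] //|i IH ti].
  rewrite /trigger_time iterS -/(trigger_time x i).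
  case E1: (trigger_time x i) => [s|] //= nt.
  have := nt; rewrite /next_trigger; case: pselect => // ex [].
  case: ex_minnP => m /andP[sm trig] mmin mt; subst m.
  case: ti sm trig nt mmin => [//|m] sm trig nt mmin.
  have hm : h m = x s.
    apply: holds => //; first exact: IH.
    by move=> t' ; rewrite nt => -[<-].
  by rewrite /h closed_loopS2 -/(h m) -/(x m.+1) hm trig.
move=> kt tkt nt; apply: holds => //; first exact: (hx k).
by move=> t' e; apply: nt; rewrite /trigger_time iterS -/(trigger_time x k) kt.
Qed.

Lemma closed_loopD s w t k :
  closed_loop s w (t + k) =
  closed_loop (closed_loop s w t) (fun i => w (t + i)%N) k.
Proof. by elim: k => [|k IH]; rewrite ?addn0 // addnS /= IH. Qed.

Lemma closed_loop_consistent x0 w t (s := closed_loop (x0, x0) w t) :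
  s.2 = s.1 \/ enorm (s.2 - s.1) <= sigma3.
Proof.
rewrite {}/s; case: t => [|t]; first by left.
rewrite closed_loopS2; case: ltP => ?; by [left | right].
Qed.

End ClosedLoop.

(* Main.v *)
Require Import Defs.
From mathcomp Require Import all_boot all_order all_algebra.
From mathcomp Require Import all_classical all_reals all_analysis.
From mathcomp Require Import ring lra.
From mathcomp.real_closed Require Import mxtens.
Import Order.TTheory GRing.Theory Num.Theory.
Import numFieldNormedType.Exports.
Local Open Scope classical_set_scope.
Local Open Scope ring_scope.

Set Implicit Arguments.
Unset Strict Implicit.
Unset Printing Implicit Defensive.

(** With [a = snorm (A + B K)] and [c ^ 2 = Tr (Sigma_w E^T E) / eps], the
    trigger rule bounds the effect of the held-state error by [(1 - a) r - c],
    so along every trajectory [|x_k| <= r + \sum_s p_s (|E w_s| - c)] with [p_s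
    = a ^ (k - 1 - s)]. Put [S = \sum_s p_s], [m = r - S c >= 0] and [Z = \sum_s
    p_s |E w_s|]; Cauchy-Schwarz gives [Z ^ 2 <= S \sum_s p_s |E w_s| ^ 2],
    whose mean is at most [eps (S c) ^ 2]. Since [(m + Z) ^ 2 <= m ^ 2 + m l +
    (1 + m / l) Z ^ 2], taking [beta = m ^ 2 + m l - r ^ 2] bounds the CVaR by
    [(m + l) ^ 2 - r ^ 2] for every [l > S c], and [l] tends to [S c].

    That [snorm M] bounds [|M x| / |x|] rests on the supremum [mu] of the
    Rayleigh quotient of a symmetric [G] being an eigenvalue: otherwise [mu - G]
    is positive semidefinite and invertible, hence coercive, and [mu] could be
    lowered. *)

(** * Inner products, coercive forms and the spectral norm *)

Section Euclidean.
Context {R : realType}.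

Definition dot n (x y : 'cV[R]_n) : R := (x^T *m y) 0 0.

Lemma dotE n (x y : 'cV[R]_n) : dot x y = \sum_i x i 0 * y i 0.
Proof. by rewrite /dot mxE; apply: eq_bigr => i _; rewrite mxE. Qed.

Lemma dotC n (x y : 'cV[R]_n) : dot x y = dot y x.
Proof. by rewrite !dotE; apply: eq_bigr => i _; rewrite mulrC. Qed.

Lemma dotDl n (x y z : 'cV[R]_n) : dot (x + y) z = dot x z + dot y z.
Proof. by rewrite /dot linearD mulmxDl mxE. Qed.

Lemma dotDr n (x y z : 'cV[R]_n) : dot z (x + y) = dot z x + dot z y.
Proof. by rewrite /dot mulmxDr mxE. Qed.

Lemma dotZl n a (x y : 'cV[R]_n) : dot (a *: x) y = a * dot x y.
Proof. by rewrite /dot linearZ -scalemxAl mxE. Qed.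

Lemma dotZr n a (x y : 'cV[R]_n) : dot x (a *: y) = a * dot x y.
Proof. by rewrite /dot -scalemxAr mxE. Qed.

Lemma dotNr n (x y : 'cV[R]_n) : dot x (- y) = - dot x y.
Proof. by rewrite -scaleN1r dotZr mulN1r. Qed.

Lemma dot_adj m n (M : 'M[R]_(m, n)) (x : 'cV[R]_m) (y : 'cV[R]_n) :
  dot x (M *m y) = dot (M^T *m x) y.
Proof. by rewrite /dot trmx_mul trmxK mulmxA. Qed.

Lemma dot_ge0 n (x : 'cV[R]_n) : 0 <= dot x x.
Proof. by rewrite dotE; apply: sumr_ge0 => i _; rewrite -expr2 sqr_ge0. Qed.

Lemma dot_eq0 n (x : 'cV[R]_n) : (dot x x == 0) = (x == 0).
Proof.
apply/eqP/eqP => [|->]; last by rewrite /dot mulmx0 mxE.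
rewrite dotE => /eqP; rewrite psumr_eq0; last first.
  by move=> i _; rewrite -expr2 sqr_ge0.
move=> /allP h; apply/matrixP => i j; rewrite ord1 mxE.
by have := h i (mem_index_enum _); rewrite /= mulf_eq0 orbb => /eqP.
Qed.

Lemma enormE n (x : 'cV[R]_n) : enorm x = Num.sqrt (dot x x).
Proof.
by rewrite /enorm dotE; congr Num.sqrt; apply: eq_bigr => i _; rewrite expr2.
Qed.

Lemma enorm_sqr n (x : 'cV[R]_n) : enorm x ^+ 2 = dot x x.
Proof. by rewrite enormE sqr_sqrtr ?dot_ge0. Qed.

Lemma enorm_ge0 n (x : 'cV[R]_n) : 0 <= enorm x.
Proof. exact: sqrtr_ge0. Qed.

(** At [s = c], [t = - b] the form equals [c (a c - b^2)], which settles [c > 0]. When [c = 0] it is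
    affine in [t] for [s = 1], so it would reach [-1] unless [b = 0]. *)
Lemma discriminant_le0 (a b c : R) :
  (forall s t, 0 <= s ^+ 2 * a + 2 * (s * t * b) + t ^+ 2 * c) ->
  b ^+ 2 <= a * c.
Proof.
move=> h; have c0 : 0 <= c by have := h 0 1; rewrite !mul0r mulr0; lra.
have [c_eq0|c_neq0] := eqVneq c 0; last first.
  have c_gt0 : 0 < c by rewrite lt_neqAle eq_sym c_neq0.
  by rewrite -subr_ge0 -(pmulr_rge0 _ c_gt0); have := h c (- b); nra.
have [->|b0] := eqVneq b 0; first by rewrite c_eq0 expr0n mulr0.
have := h 1 (- (a + 1) / (2 * b)); rewrite c_eq0.
have -> : 1 ^+ 2 * a + 2 * (1 * (- (a + 1) / (2 * b)) * b)
          + (- (a + 1) / (2 * b)) ^+ 2 * 0 = - 1 by field.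
by rewrite oppr_ge0 ler10.
Qed.

Lemma psd_Cauchy_Schwarz n (N : 'M[R]_n) (x y : 'cV[R]_n) : N^T = N ->
  (forall z : 'cV[R]_n, 0 <= dot z (N *m z)) ->
  dot x (N *m y) ^+ 2 <= dot x (N *m x) * dot y (N *m y).
Proof.
move=> symN psdN; apply: discriminant_le0 => s t.
have := psdN (s *: x + t *: y).
rewrite mulmxDr -!scalemxAr !(dotDl, dotDr, dotZl, dotZr).
have -> : dot y (N *m x) = dot x (N *m y) by rewrite dot_adj symN dotC.
by congr (0 <= _); ring.
Qed.

Lemma Cauchy_Schwarz_dot n (x y : 'cV[R]_n) :
  dot x y ^+ 2 <= dot x x * dot y y.
Proof.
have := @psd_Cauchy_Schwarz n 1%:M x y (trmx1 _ _); rewrite !mul1mx.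
by apply=> z; rewrite mul1mx dot_ge0.
Qed.

Lemma dot_le_enorm n (x y : 'cV[R]_n) : dot x y <= enorm x * enorm y.
Proof.
rewrite (le_trans (ler_norm _))// -ler_sqr ?nnegrE ?mulr_ge0 ?enorm_ge0//.
by rewrite exprMn !enorm_sqr real_normK ?num_real// Cauchy_Schwarz_dot.
Qed.

Lemma enormD n (x y : 'cV[R]_n) : enorm (x + y) <= enorm x + enorm y.
Proof.
rewrite -ler_sqr ?nnegrE ?addr_ge0 ?enorm_ge0//.
rewrite sqrrD !enorm_sqr dotDl !dotDr (dotC y x).
have := dot_le_enorm x y; lra.
Qed.

Lemma dot_mulmx_bounded n (G : 'M[R]_n) :
  exists2 C : R, 0 < C & forall x, dot x (G *m x) <= C * dot x x.
Proof.
(* Each [|x_i x_j|] is at most [|x|^2]; the summand 1 keeps the constant positive even for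
   [G = 0]. *)
exists (1 + \sum_i \sum_j `|G i j|) => [|x].
  by rewrite ltr_pwDl// sumr_ge0// => i _; rewrite sumr_ge0.
rewrite mulrDl mul1r ler_wpDl ?dot_ge0// dotE mulr_suml ler_sum// => i _.
rewrite mxE mulr_sumr mulr_suml ler_sum// => j _.
rewrite mulrCA (le_trans (ler_norm _))// normrM; apply: ler_wpM2l => //.
have xle k : x k 0 ^+ 2 <= dot x x.
  rewrite dotE (bigD1 k)//= -expr2 lerDl sumr_ge0// => l _.
  by rewrite -expr2 sqr_ge0.
rewrite ler_norml; have := xle i; have := xle j.
have := sqr_ge0 (x i 0 + x j 0); have := sqr_ge0 (x i 0 - x j 0).
by move=> *; apply/andP; split; nra.
Qed.

(** With [y = N x], Cauchy-Schwarz for the form of [N] gives [|y|^4 <= <y, N y> <x, N x> <= C |y|^2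
    <x, N x>], and boundedness of the inverse gives [|x|^2 <= D |y|^2]. *)
Lemma psd_unitmx_coercive n (N : 'M[R]_n) : N^T = N ->
  (forall z : 'cV[R]_n, 0 <= dot z (N *m z)) -> N \in unitmx ->
  exists2 c : R, 0 < c & forall x, c * dot x x <= dot x (N *m x).
Proof.
move=> symN psdN unitN.
have [C C0 hC] := dot_mulmx_bounded N.
have [D D0 hD] := dot_mulmx_bounded ((invmx N)^T *m invmx N).
exists (D * C)^-1 => [|x]; first by rewrite invr_gt0 mulr_gt0.
rewrite mulrC ler_pdivrMr ?mulr_gt0//; set y := N *m x.
have xy : dot x x <= D * dot y y.
  by have := hD y; rewrite -mulmxA dot_adj trmxK mulmxA mulVmx// mul1mx.
rewrite mulrC -mulrA (le_trans xy)// ler_pM2l//.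
have [/eqP|y0] := eqVneq (dot y y) 0.
  by rewrite dot_eq0 => /eqP ->; rewrite /dot !mulmx0 !mxE mulr0.
have ygt0 : 0 < dot y y by rewrite lt_neqAle eq_sym y0 dot_ge0.
rewrite -(ler_pM2r ygt0) -expr2 {1}/y
  (le_trans (psd_Cauchy_Schwarz _ _ symN psdN))//.
by rewrite -mulrA mulrCA mulrC; apply: ler_wpM2l; [exact: psdN | exact: hC].
Qed.

Lemma max_eigenvalue n (G : 'M[R]_n.+1) : G^T = G ->
  exists2 mu, eigenvalue G mu & forall x, dot x (G *m x) <= mu * dot x x.
Proof.
move=> symG; have [C C0 hC] := dot_mulmx_bounded G.
pose S := [set dot x (G *m x) / dot x x | x in [set x : 'cV[R]_n.+1 | x != 0]].
have dot_gt0 (x : 'cV[R]_n.+1) : x != 0 -> 0 < dot x x.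
  by move=> x0; rewrite lt_neqAle eq_sym dot_eq0 x0 dot_ge0.
have S0 : S !=set0.
  exists (dot (const_mx 1) (G *m const_mx 1) /
          dot (const_mx 1) (const_mx 1 : 'cV[R]_n.+1)).
  exists (const_mx 1) => //=; apply/eqP => /matrixP /(_ 0 0).
  by rewrite !mxE; apply/eqP; rewrite oner_eq0.
have ubS : has_ubound S.
  by exists C => _ [x /= x0 <-]; rewrite ler_pdivrMr ?dot_gt0.
have hmu x : dot x (G *m x) <= sup S * dot x x.
  have [->|x0] := eqVneq x 0; first by rewrite mulmx0 /dot mulmx0 mxE mulr0.
  by rewrite -ler_pdivrMr ?dot_gt0//; apply: ub_le_sup => //; exists x.
exists (sup S) => //; apply: contraT => Neig.
pose N := (sup S)%:M - G.
have NE x : dot x (N *m x) = sup S * dot x x - dot x (G *m x).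
  by rewrite mulmxBl mul_scalar_mx dotDr dotZr dotNr.
have symN : N^T = N by rewrite /N linearB /= tr_scalar_mx symG.
have unitN : N \in unitmx.
  (* [eigenvalue] speaks of the kernel of [G - (sup S)%:M], the opposite of [N]. *)
  rewrite -row_free_unit -row_leq_rank -mxrank_opp opprB row_leq_rank.
  by rewrite -kermx_eq0; move: Neig; rewrite /eigenvalue negbK.
have [|c c0 hc] := psd_unitmx_coercive symN _ unitN.
  by move=> z; rewrite NE subr_ge0.
suff : sup S <= sup S - c by rewrite lerBrDr gerDl leNgt c0.
apply: ge_sup => // _ [x /= x0 <-]; rewrite ler_pdivrMr ?dot_gt0//.
by have := hc x; rewrite NE; lra.
Qed.

Lemma snorm_ge0 m n (M : 'M[R]_(m, n)) : 0 <= snorm M.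
Proof.
rewrite /snorm; have [[[s Ms] ubM]|/sup_out ->//] :=
  pselect (has_sup (singular_values M)).
rewrite (le_trans _ (ub_le_sup ubM Ms))//; case: Ms => a _ <-.
exact: sqrtr_ge0.
Qed.

Lemma enorm_mulmx m n (M : 'M[R]_(m, n)) (x : 'cV[R]_n) :
  enorm (M *m x) <= snorm M * enorm x.
Proof.
case: n M x => [|n] M x.
  rewrite (flatmx0 x) mulmx0 {1}enormE /dot mulmx0 mxE sqrtr0.
  by rewrite mulr_ge0 ?snorm_ge0 ?enorm_ge0.
pose G := M^T *m M; have symG : G^T = G by rewrite trmx_mul trmxK.
have dotG y : dot y (G *m y) = dot (M *m y) (M *m y).
  by rewrite -mulmxA dot_adj trmxK.
have [mu eig hmu] := max_eigenvalue symG.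
(* Bounds all singular values by [Num.sqrt mu], so that [sup] in [snorm] is a genuine supremum.
   Eigenvectors are rows; symmetry of [G] allows transposing them. *)
have eig_le a : eigenvalue G a -> 0 <= a <= mu.
  case/eigenvalueP => v vG v0; pose y := v^T.
  have Gy : G *m y = a *: y.
    by rewrite -[G]symG -trmx_mul vG linearZ.
  have y0 : 0 < dot y y.
    rewrite lt_neqAle eq_sym dot_ge0 dot_eq0 andbT.
    by rewrite -[0]trmx0 (inj_eq (@trmx_inj _ _ _)).
  have := hmu y; rewrite Gy dotZr ler_pM2r// => ->; rewrite andbT.
  by rewrite -(pmulr_lge0 _ y0) -dotZr -Gy dotG dot_ge0.
have /andP[mu0 _] := eig_le _ eig.
have le_snorm : Num.sqrt mu <= snorm M.
  apply: ub_le_sup; last by exists mu.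
  by exists (Num.sqrt mu) => _ [a /eig_le /andP[a0 amu] <-]; rewrite ler_sqrt.
rewrite (le_trans _ (ler_wpM2r (enorm_ge0 x) le_snorm))//.
by rewrite !enormE -sqrtrM// ler_sqrt ?mulr_ge0 ?dot_ge0// -dotG.
Qed.

End Euclidean.

(** Discriminant of the nonnegative form [\sum_i p_i (s + t g_i)^2]. *)
Lemma weighted_sum_sqr_le (R : realType) (I : finType) (p g : I -> R) :
  (forall i, 0 <= p i) ->
  (\sum_i p i * g i) ^+ 2 <= (\sum_i p i) * (\sum_i p i * g i ^+ 2).
Proof.
move=> p0; apply: discriminant_le0 => s t.
suff -> : s ^+ 2 * \sum_i p i + 2 * (s * t * \sum_i p i * g i)
    + t ^+ 2 * \sum_i p i * g i ^+ 2 = \sum_i p i * (s + t * g i) ^+ 2.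
  by apply: sumr_ge0 => i _; rewrite mulr_ge0 ?sqr_ge0.
rewrite !mulr_sumr -!big_split /=; apply: eq_bigr => i _; ring.
Qed.

(** * Trajectories under the trigger rule *)

Section ClosedLoopBound.
Context {R : realType} {nx nu nw : nat}.
Variables (A : 'M[R]_nx) (B : 'M[R]_(nx, nu)) (E : 'M[R]_(nx, nw)).
Variables (K : 'M[R]_(nu, nx)) (sigma3 : R).

Let consistent (s : 'cV[R]_nx * 'cV[R]_nx) :=
  s.2 = s.1 \/ enorm (s.2 - s.1) <= sigma3.

Lemma consistent_closed_loop s w k :
  consistent s -> consistent (closed_loop A B E K sigma3 s w k).
Proof.
rewrite /consistent; case: k => // k _.
by rewrite closed_loopS2; case: ltP => ?; [left | right].
Qed.

(** One step gives [|x'| <= a |x| + d + |E w|]. Since [a r + d = r - c], the excess over [r] is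
    multiplied by [a] and increased by [|E w| - c]. *)
Lemma enorm_closed_loop_le (r c d : R) s w k :
  0 <= d -> snorm (B *m K) * sigma3 <= d ->
  snorm (A + B *m K) * r + d = r - c ->
  consistent s -> enorm s.1 <= r ->
  enorm (closed_loop A B E K sigma3 s w k).1 <=
    r + \sum_(i < k) snorm (A + B *m K) ^+ (k - i.+1) * (enorm (E *m w i) - c).
Proof.
set a := snorm (A + _); move=> d0 hsigma rE cons_s sr.
elim: k => [|k IH]; first by rewrite big_ord0 addr0.
rewrite closed_loopS1 big_ord_recr /= subnn expr0 mul1r.
have -> : \sum_(i < k) a ^+ (k.+1 - i.+1) * (enorm (E *m w i) - c)
    = a * \sum_(i < k) a ^+ (k - i.+1) * (enorm (E *m w i) - c).
  rewrite mulr_sumr; apply: eq_bigr => i _.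
  by rewrite subSn// exprS mulrA.
have := consistent_closed_loop w k cons_s.
move: IH; case: (closed_loop A B E K sigma3 s w k) => x xhat /= IH cons_x.
have -> : A *m x + B *m (K *m xhat) + E *m w k
    = (A + B *m K) *m x + (B *m K) *m (xhat - x) + E *m w k.
  by rewrite mulmxBr mulmxDl -!mulmxA addrA addrAC addrK addrAC.
have held_error : enorm ((B *m K) *m (xhat - x)) <= d.
  case: cons_x => /= [->|err].
    by rewrite subrr mulmx0 enormE /dot mulmx0 mxE sqrtr0.
  rewrite (le_trans (enorm_mulmx _ _))// (le_trans _ hsigma)//.
  by rewrite ler_wpM2l// snorm_ge0.
have step : enorm ((A + B *m K) *m x) <=
    a * (r + \sum_(i < k) a ^+ (k - i.+1) * (enorm (E *m w i) - c)).
  by rewrite (le_trans (enorm_mulmx _ _))// ler_wpM2l// snorm_ge0.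
have := enormD ((A + B *m K) *m x + (B *m K) *m (xhat - x)) (E *m w k).
have := enormD ((A + B *m K) *m x) ((B *m K) *m (xhat - x)).
move: step; rewrite mulrDr; lra.
Qed.

End ClosedLoopBound.

(** * CVaR bounds from second moments *)

Section CVaRBound.
Context {d : measure_display} {T : measurableType d} {R : realType}.
Variable P : probability T R.

(* Unlike the library's [expectation_le], no measurability is required, so the
   closed-loop map need not be shown measurable. *)
Lemma le_expectation (X Y : T -> R) :
  (forall w, 0 <= X w <= Y w) -> ('E_P[X] <= 'E_P[Y])%E.
Proof.
move=> XY; rewrite unlock !ge0_integralTE; last 2 first.
- by move=> w; have /andP[X0 /(le_trans X0)] := XY w.
- by move=> w; have /andP[] := XY w.
(* Each integral is a supremum over simple functions below the integrand, and those below [X] are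
   below [Y]. *)
apply: le_ereal_sup => _ [h /= hX <-]; exists h => // w.
by apply: le_trans (hX w) _; rewrite lee_fin; case/andP: (XY w).
Qed.

(** One [beta] bounds the infimum, and [U] dominates the positive part of [L - beta]. *)
Lemma CVaR_le (eps beta t : R) (L U : T -> R) : 0 < eps ->
  (forall w, 0 <= U w) -> (forall w, L w <= beta + U w) ->
  ('E_P[U] <= t%:E)%E -> (CVaR eps P L <= (beta + 1 / eps * t)%:E)%E.
Proof.
move=> eps0 U0 LU EU; apply: (@le_trans _ _ (beta%:E + (1 / eps)%:E *
    'E_P[(fun w => Num.max (L w - beta) 0)%R])%E).
  by apply: ereal_inf_lbound; exists beta.
rewrite EFinD leeD2l// !div1r EFinM; apply: lee_wpmul2l.
  by rewrite lee_fin invr_ge0 ltW.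
apply: le_trans EU; apply: le_expectation => w.
by rewrite le_max lexx orbT ge_max U0 andbT lerBlDl LU.
Qed.

Lemma CVaR_sqr_le (eps m l r : R) (Y Z V : T -> R) :
  0 < eps -> 0 <= m -> 0 < l ->
  (forall w, 0 <= Y w <= m + Z w) ->
  (forall w, Z w ^+ 2 <= V w) -> V \in Lfun P 1 ->
  ('E_P[V] <= (eps * l ^+ 2)%:E)%E ->
  (CVaR eps P (fun w => Y w ^+ 2 - r ^+ 2)%R <= ((m + l) ^+ 2 - r ^+ 2)%:E)%E.
Proof.
move=> eps0 m0 l0 hY hZ intV EV.
have k0 : 0 <= 1 + m / l by rewrite addr_ge0// divr_ge0// ltW.
(* The first three terms are [beta]; the last factor [(1 + m / l) * (eps * l ^+ 2)] bounds the mean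
   of [(1 + m / l) V]. *)
have -> : (m + l) ^+ 2 - r ^+ 2 =
    m ^+ 2 + m * l - r ^+ 2 + 1 / eps * ((1 + m / l) * (eps * l ^+ 2)).
  by field; rewrite !gt_eqF.
apply: (@CVaR_le _ _ _ _ ((1 + m / l) \o* V)) => //=.
- by move=> w; rewrite mulr_ge0// (le_trans _ (hZ w)) ?sqr_ge0.
- move=> w; have /andP[Y0 YZ] := hY w.
  have YZ2 : Y w ^+ 2 <= (m + Z w) ^+ 2.
    by rewrite ler_sqr ?nnegrE// (le_trans Y0).
  (* AM-GM: [2 Z <= l + Z^2 / l] *)
  have amgm : 2 * Z w <= l + Z w ^+ 2 / l.
    rewrite -subr_ge0.
    have -> : l + Z w ^+ 2 / l - 2 * Z w = (Z w - l) ^+ 2 / l.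
      by field; rewrite gt_eqF.
    by rewrite divr_ge0 ?sqr_ge0// ltW.
  have := ler_wpM2l m0 amgm; have := ler_wpM2r k0 (hZ w); lra.
- by rewrite expectationZl// EFinM; exact: lee_wpmul2l.
Qed.

(** Serves twice: for the quadratic form of one disturbance block, and for the weighted sum over
    time. *)
Lemma expectation_lincomb (I : finType) (c t : I -> R) (f : I -> T -> R) :
  (forall i, f i \in Lfun P 1) -> (forall i, 'E_P[f i] = (t i)%:E)%E ->
  (fun w => \sum_i c i * f i w) \in Lfun P 1 /\
  ('E_P[(fun w => \sum_i c i * f i w)%R] = (\sum_i c i * t i)%:E)%E.
Proof.
move=> intf Ef.
have intcf i : P.-integrable setT (fun w => (c i * f i w)%:E).
  have : P.-integrable setT (EFin \o f i) by apply/Lfun1_integrable.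
  exact: integrableZl.
have sumE : EFin \o (fun w => \sum_i c i * f i w)
    = (fun w => (\sum_i (c i * f i w)%:E)%E).
  by apply/funext => w; rewrite /= sumEFin.
split; first by apply/Lfun1_integrable; rewrite sumE; exact: integrable_sum.
rewrite unlock -/(EFin \o _) [X in integral _ _ X]sumE integral_sum//.
rewrite -sumEFin; apply: eq_bigr => i _.
rewrite EFinM -(Ef i) unlock -integralZl//.
by apply/Lfun1_integrable.
Qed.

End CVaRBound.

(** * Second moments of the disturbance blocks *)

Section DisturbanceMoments.
Context {R : realType} {nx nw k : nat}.
Variables (S : 'M[R]_nw) (E : 'M[R]_(nx, nw)).
Variable P : probability ((k * nw).-tuple R) R.
Hypothesis lawP : disturbance_laws S k P.

(** The means vanish, so the covariance is the mean of the product; both indices lie in block [s],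
    where the identity factor of the Kronecker product is 1. *)
Lemma block_second_moment (s : 'I_k) (i j : 'I_nw) :
  (fun w => block w s i 0 * block w s j 0) \in Lfun P 1 /\
  ('E_P[(fun w => block w s i 0 * block w s j 0)%R] = (S i j)%:E)%E.
Proof.
have blockE w l : block w s l 0 = tnth w (mxtens_index (s, l)).
  by rewrite mxE valK.
case: lawP => L2 mean0 covP.
have finP : P setT \is a fin_num by rewrite probability_setT.
set X := fun w : (k * nw).-tuple R => tnth w (mxtens_index (s, i)).
set Y := fun w : (k * nw).-tuple R => tnth w (mxtens_index (s, j)).
have -> : (fun w => block w s i 0 * block w s j 0) = (X * Y)%R.
  by apply/funext => w; rewrite !blockE.
have intXY : (X * Y)%R \in Lfun P 1 by apply: Lfun2_mul_Lfun1; apply: L2.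
split=> //.
have := covP (mxtens_index (s, i)) (mxtens_index (s, j)).
rewrite tensmxE !mxE eqxx mul1r => <-.
rewrite covarianceE//; try by apply: Lfun_subset12 => //; apply: L2.
by rewrite !mean0 mule0 sube0.
Qed.

(** Expands [|E w|^2] as [\sum_(i, j) G_ij w_i w_j] with [G = E^T E], whose mean is the trace of
    [S G]. *)
Lemma enorm_sqr_block_moment (s : 'I_k) :
  (fun w => enorm (E *m block w s) ^+ 2) \in Lfun P 1 /\
  ('E_P[(fun w => enorm (E *m block w s) ^+ 2)%R]
     = (\tr (S *m E^T *m E))%:E)%E.
Proof.
pose G := E^T *m E.
have trG : G^T = G by rewrite trmx_mul trmxK.
have symG i j : G i j = G j i by rewrite -[in LHS]trG mxE.
have [] := @expectation_lincomb _ _ _ P ('I_nw * 'I_nw)%type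
  (fun p => G p.1 p.2) (fun p => S p.1 p.2)
  (fun p w => block w s p.1 0 * block w s p.2 0).
- by move=> p; case: (block_second_moment s p.1 p.2).
- by move=> p; case: (block_second_moment s p.1 p.2).
have -> : \sum_p G p.1 p.2 * S p.1 p.2 = \tr (S *m E^T *m E).
  rewrite -mulmxA -/G /mxtrace -(pair_bigA _ (fun i j => G i j * S i j)) /=.
  apply: eq_bigr => i _; rewrite mxE; apply: eq_bigr => j _.
  by rewrite mulrC symG.
suff -> : (fun w => \sum_p G p.1 p.2 * (block w s p.1 0 * block w s p.2 0))
    = (fun w : (k * nw).-tuple R => enorm (E *m block w s) ^+ 2) by [].
apply/funext => w; rewrite enorm_sqr dot_adj mulmxA -/G dotE.
rewrite -(pair_bigA _ (fun i j => G i j * (block w s i 0 * block w s j 0))) /=.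
apply: eq_bigr => i _; rewrite [in RHS]mxE mulr_suml.
by apply: eq_bigr => j _; ring.
Qed.

End DisturbanceMoments.

Theorem corollaryV3 (R : realType) (nx nu nw : nat)
    (A : 'M[R]_nx) (B : 'M[R]_(nx, nu)) (E : 'M[R]_(nx, nw))
    (K : 'M[R]_(nu, nx)) (Sigma_w : 'M[R]_nw) (eps r sigma3 : R)
    (hSigma : posdefmx Sigma_w)
    (heps : 0 < eps < 1)
    (hnorm : snorm (A + B *m K) < 1)
    (hreach : reachable (A + B *m K) E)
    (hBK : B *m K != 0)
    (hr : 0 < r)
    (hr2 : 1 / (1 - snorm (A + B *m K)) ^+ 2
             * (1 / eps * \tr (Sigma_w *m E^T *m E)) < r ^+ 2)
    (hsigma3 : sigma3 <= 1 / snorm (B *m K)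
             * ((1 - snorm (A + B *m K)) * r
                - Num.sqrt (1 / eps * \tr (Sigma_w *m E^T *m E)))) :
  forall x xhat : 'cV[R]_nx,
    safe_set r x ->
    xhat = x \/ enorm (xhat - x) <= sigma3 ->
    forall k : nat, (0 < k)%N ->
      (worst_case_CVaR eps (disturbance_laws Sigma_w k)
         (fun w : (k * nw).-tuple R =>
            (enorm (closed_loop A B E K sigma3 (x, xhat) (block w) k).1 ^+ 2
               - r ^+ 2)%R)
       <= 0)%E.
Proof.
move=> x xhat; rewrite /safe_set /= subr_le0 => xr xxhat k _.
have xr' : enorm x <= r by rewrite -ler_sqr ?nnegrE ?enorm_ge0 ?(ltW hr).
case/andP: heps => eps0 _.
set a := snorm (A + B *m K) in hnorm hr2 hsigma3 *.
set tau := \tr (Sigma_w *m E^T *m E) in hr2 hsigma3.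
set c := Num.sqrt (1 / eps * tau) in hsigma3.
have a0 : 0 <= a := snorm_ge0 _.
have c0 : 0 <= c := sqrtr_ge0 _.
have c_lt : c < (1 - a) * r.
  have a1 : 0 < 1 - a by rewrite subr_gt0.
  have ar0 : 0 < (1 - a) * r by rewrite mulr_gt0.
  rewrite -[ltRHS]gtr0_norm// -sqrtr_sqr ltr_sqrt ?exprn_gt0// exprMn.
  by rewrite -ltr_pdivrMl ?exprn_gt0// -[(_ ^+ _)^-1]div1r.
(* Equality when the radicand is nonnegative; otherwise [c = 0], since [Num.sqrt] is 0 there, and
   [tau] is negative. *)
have tau_le : tau <= eps * c ^+ 2.
  rewrite -ler_pdivrMl// -div1r; have [t0|t0] := leP 0 (1 / eps * tau).
    by rewrite sqr_sqrtr.
  by rewrite (le_trans (ltW t0)) ?sqr_ge0.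
pose d := (1 - a) * r - c.
have d0 : 0 <= d by rewrite subr_ge0 ltW.
have held_le : snorm (B *m K) * sigma3 <= d.
  have [b0|b0] := eqVneq (snorm (B *m K)) 0; first by rewrite b0 mul0r.
  have {}b0 : 0 < snorm (B *m K) by rewrite lt_neqAle eq_sym b0 snorm_ge0.
  by rewrite mulrC -ler_pdivlMr// mulrC -div1r.
pose p (i : 'I_k) := a ^+ (k - i.+1); pose S := \sum_i p i.
have p0 i : 0 <= p i by rewrite exprn_ge0.
have S0 : 0 <= S by apply: sumr_ge0.
have S_le : S * (1 - a) <= 1.
  rewrite /S (reindex_inj rev_ord_inj) /=.
  have -> : \sum_(j < k) p (rev_ord j) = \sum_(j < k) a ^+ j.
    by apply: eq_bigr => j _; rewrite /p /= subnSK// subKn// ltnW.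
  by rewrite mulrC -opprB mulNr -subrX1 opprB gerBl exprn_ge0.
(* [S c <= S (1 - a) r <= r]. *)
have m0 : 0 <= r - S * c by nra.
apply: ge_ereal_sup => _ [P lawP <-].
apply/lee_addgt0Pr => e e0; rewrite add0e.
(* [l = S c + delta] is positive even if [S c = 0], and [m + l = r + delta]; as [delta <= 1], [(r +
   delta)^2 - r^2 <= delta (2 r + 1) <= e]. *)
pose delta := Num.min 1 (e / (2 * r + 1)).
have r1 : 0 < 2 * r + 1 by lra.
have delta0 : 0 < delta by rewrite lt_min ltr01 divr_gt0.
have delta_le : (r - S * c + (S * c + delta)) ^+ 2 - r ^+ 2 <= e.
  have d1 : delta <= 1 by rewrite ge_min lexx.
  have : delta * (2 * r + 1) <= e by rewrite -ler_pdivlMr// ge_min lexx orbT.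
  nra.
(* The weights [S p_i] are those of the Cauchy-Schwarz bound on [Z ^ 2]. *)
have [intV EV] := expectation_lincomb (fun i => S * p i)
  (fun i => (enorm_sqr_block_moment E lawP i).1)
  (fun i => (enorm_sqr_block_moment E lawP i).2).
apply: (@le_trans _ _ ((r - S * c + (S * c + delta)) ^+ 2 - r ^+ 2)%:E);
  last by rewrite lee_fin.
apply: (@CVaR_sqr_le _ _ _ P eps (r - S * c) (S * c + delta) r _
  (fun w => \sum_i p i * enorm (E *m block w i)) _ eps0 m0 _ _ _ intV).
- by rewrite ltr_wpDl// mulr_ge0.
- move=> w; rewrite enorm_ge0 /=.
  have arE : a * r + d = r - c by rewrite /d; ring.
  apply: (le_trans (enorm_closed_loop_le E (s := (x, xhat)) (block w) k d0
    held_le arE xxhat xr')).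
  rewrite -addrA lerD2l mulr_suml addrC -sumrB ler_sum// => i _.
  by rewrite -/(p i) mulrBr.
- move=> w; under [leRHS]eq_bigr do rewrite -mulrA; rewrite -mulr_sumr.
  exact: weighted_sum_sqr_le.
(* The mean is [S^2 tau <= eps (S c)^2 <= eps (S c + delta)^2]. *)
- rewrite EV lee_fin -mulr_suml -mulr_sumr -/S -/tau -expr2.
  rewrite (le_trans (ler_wpM2l (sqr_ge0 S) tau_le))// mulrCA ler_pM2l//.
  have Sc0 : 0 <= S * c by exact: mulr_ge0.
  by rewrite -exprMn ler_sqr ?nnegrE ?addr_ge0 ?lerDl ?(ltW delta0).
Qed.
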